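(* Let $M$ be a common meadow. Then: (1) $M$ satisfies $\mathsf{NVL}$ if and only if $0\cdot M=\{\mathbf{a},0\}$. (2) If $M$ satisfies $\mathsf{AVL}$, then $M_z$ is a field for every minimal element $z\in 0\cdot M\setminus\{\mathbf{a}\}$. (3) $M$ satisfies both $\mathsf{NVL}$ and $\mathsf{AVL}$ if and only if $M=\mathbb{F}\sqcup\{\mathbf{a}\}$, where $\mathbb{F}$ is a field. (4) $M$ satisfies $\mathsf{CIL}$ if and only if $M=M_0\sqcup\{\mathbf{a}\}$ and $M_0$ is a field.
   Context: A common meadow is a set $M$ with constants $0,1,\mathbf{a}$, binary operations $+,\cdot$ and unary operations $-$ and $(\cdot)^{-1}$ such that for all $x,y,z\in M$: $(x+y)+z=x+(y+z)$; $x+y=y+x$; $x+0=x$; $x+(-x)=0\cdot x$; $(x\cdot y)\cdot z=x\cdot(y\cdot z)$; $x\cdot y=y\cdot x$; $1\cdot x=x$; $x\cdot(y+z)=x\cdot y+x\cdot z$; $-(-x)=x$; $x\cdot x^{-1}=1+0\cdot x^{-1}$; $(x\cdot y)^{-1}=x^{-1}\cdot y^{-1}$; $(1+0\cdot x)^{-1}=1+0\cdot x$; $0^{-1}=\mathbf{a}$; $x+\mathbf{a}=\mathbf{a}$. $0\cdot M=\{0\cdot x\mid x\in M\}$ is partially ordered by $z\leq z'$ iff $z\cdot z'=z$; in (2), ''minimal'' means minimal in $0\cdot M\setminus\{\mathbf{a}\}$ for this order. For $z\in 0\cdot M$, $M_z=\{x\in M\mid 0\cdot x=z\}$ is a commutative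 ring with zero $z$ and identity $1+z$; in particular $M_0=\{x\in M\mid 0\cdot x=0\}$. The laws are: $\mathsf{NVL}$ (Normal Value Law): for all $x$, $x\neq\mathbf{a}\Rightarrow 0\cdot x=0$. $\mathsf{AVL}$ (Additional Value Law): for all $x$, $x^{-1}=\mathbf{a}\Rightarrow 0\cdot x=x$. $\mathsf{CIL}$ (Common Inverse Law): for all $x$, $x\neq 0$ and $x\neq\mathbf{a}$ imply $x\cdot x^{-1}=1$. For a field $\mathbb{F}$, ''$M=\mathbb{F}\sqcup\{\mathbf{a}\}$'' means that $M$ is the disjoint union of $\{\mathbf{a}\}$ and a subset $\mathbb{F}$ which, with the constants $0,1$ and operations $+,-,\cdot$ of $M$, is a field (sums and products with $\mathbf{a}$ equal $\mathbf{a}$).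
   Formalization: Parts (3) and (4) are stated for common meadows with 0 ≠ a; the one-element common meadow (0 = 1 = a) satisfies NVL, AVL and CIL but is not the disjoint union of a field and {a}, so the forward directions fail there. *)

(* Defs.v *)
From mathcomp Require Import all_boot all_order all_algebra.
From mathcomp Require Import boolp classical_sets.

Set Implicit Arguments.
Unset Strict Implicit.
Unset Printing Implicit Defensive.

Declare Scope meadow_scope.
Delimit Scope meadow_scope with Md.

Record commonMeadow := CommonMeadow {
  cm_sort :> Type;
  cm0 : cm_sort;
  cm1 : cm_sort;
  cma : cm_sort;
  cmadd : cm_sort -> cm_sort -> cm_sort;
  cmmul : cm_sort -> cm_sort -> cm_sort;
  cmopp : cm_sort -> cm_sort;
  cminv : cm_sort -> cm_sort;
  cmaddA : forall x y z, cmadd (cmadd x y) z = cmadd x (cmadd y z);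
  cmaddC : forall x y, cmadd x y = cmadd y x;
  cmaddr0 : forall x, cmadd x cm0 = x;
  cmaddrN : forall x, cmadd x (cmopp x) = cmmul cm0 x;
  cmmulA : forall x y z, cmmul (cmmul x y) z = cmmul x (cmmul y z);
  cmmulC : forall x y, cmmul x y = cmmul y x;
  cmmul1r : forall x, cmmul cm1 x = x;
  cmmulDr : forall x y z, cmmul x (cmadd y z) = cmadd (cmmul x y) (cmmul x z);
  cmoppK : forall x, cmopp (cmopp x) = x;
  cmmulrV : forall x, cmmul x (cminv x) = cmadd cm1 (cmmul cm0 (cminv x));
  cminvM : forall x y, cminv (cmmul x y) = cmmul (cminv x) (cminv y);
  cminv1D0 : forall x, cminv (cmadd cm1 (cmmul cm0 x)) = cmadd cm1 (cmmul cm0 x);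
  cminv0 : cminv cm0 = cma;
  cmaddra : forall x, cmadd x cma = cma
}.

Arguments cm0 {c}.
Arguments cm1 {c}.
Arguments cma {c}.

Notation "0" := cm0 : meadow_scope.
Notation "1" := cm1 : meadow_scope.
Notation "\a" := cma (at level 0) : meadow_scope.
Infix "+" := cmadd : meadow_scope.
Infix "*" := cmmul : meadow_scope.
Notation "- x" := (cmopp x) : meadow_scope.
Notation "x ^-1" := (cminv x) : meadow_scope.

Local Open Scope classical_set_scope.
Local Open Scope meadow_scope.

Section CommonMeadowDefs.
Variable M : commonMeadow.

(* The axioms admit the one-element meadow, where 0 = \a; it satisfies NVL, AVL
   and CIL but contains no field, and 0 and \a cannot be separated. *)
Definition nontrivial := (0 : M) <> \a.

Definition NVL := forall x : M, x <> \a -> 0 * x = 0.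
Definition AVL := forall x : M, x^-1 = \a -> 0 * x = x.
Definition CIL := forall x : M, x <> 0 -> x <> \a -> x * x^-1 = 1.

Definition zeros : set M := [set 0 * x | x in [set: M]].

Definition zle (z z' : M) := z * z' = z.

Definition zminimal (A : set M) (z : M) :=
  A z /\ forall z', A z' -> zle z' z -> z' = z.

Definition fiber (z : M) : set M := [set x | 0 * x = z].

(* The subset [S], with zero [z], identity [e] and the operations +, -, * of
   [M], is a field: these data are the image of a [fieldType] under an injection
   respecting them.  The inverse of the field is not required to be the inverse
   of [M] (in [M], the inverse of 0 is \a). *)
Definition is_field_on (S : set M) (z e : M) :=
  exists (F : fieldType) (i : F -> M),
    [/\ injective i /\ range i = S,
        i 0%R = z /\ i 1%R = e,
        (forall u v, i (u + v)%R = i u + i v),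
        (forall u, i (- u)%R = - i u) &
        (forall u v, i (u * v)%R = i u * i v)].

Definition fiber_is_field (z : M) := is_field_on (fiber z) z (1 + z).

(* M = S |_| {a} *)
Definition is_adjunction_of_a (S : set M) :=
  [/\ S `|` [set \a] = [set: M],
      S `&` [set \a] = set0 &
      forall x : M, x + \a = \a /\ x * \a = \a].

End CommonMeadowDefs.

Arguments zeros M : clear implicits.

(* Main.v *)
Require Import Defs.
From HB Require Import structures.
From mathcomp Require Import all_boot all_order all_algebra.
From mathcomp Require Import boolp classical_sets.

Set Implicit Arguments.
Unset Strict Implicit.
Unset Printing Implicit Defensive.

Local Open Scope classical_set_scope.
Local Open Scope meadow_scope.

(** In [M_z], an element [x <> z] has [0 * x^-1 <= z], because multiplying
    [x * x^-1 = 1 + 0 * x^-1] by [0] gives [z * (0 * x^-1) = 0 * x^-1].  Under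
    AVL, [x^-1 <> \a], so minimality of [z] forces [0 * x^-1 = z] and [x^-1] is
    the inverse of [x] in the ring [M_z].  Under NVL the only candidate for [z]
    is [0], and CIL is equivalent to NVL and AVL together. *)

Section CommonMeadowTheory.
Context {M : commonMeadow}.
Implicit Types x y z : M.

Lemma cmadd0r x : 0 + x = x.
Proof. by rewrite cmaddC cmaddr0. Qed.

Lemma cmmulr1 x : x * 1 = x.
Proof. by rewrite cmmulC cmmul1r. Qed.

Lemma cmmulDl x y z : (x + y) * z = x * z + y * z.
Proof. by rewrite cmmulC cmmulDr !(cmmulC z). Qed.

Lemma cmmul00 : 0 * 0 = 0 :> M.
Proof.
have := cmmulDr (0 : M) 1 0.
by rewrite cmaddr0 cmmulr1 cmadd0r => <-.
Qed.

Lemma cmmul0K x : 0 * (0 * x) = 0 * x.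
Proof. by rewrite -cmmulA cmmul00. Qed.

Lemma cmaddr_mul0 x : x + 0 * x = x.
Proof. by rewrite (cmmulC 0) -{1}(cmmulr1 x) -cmmulDr cmaddr0 cmmulr1. Qed.

Lemma cmmul0_add x : 0 * x + 0 * x = 0 * x.
Proof. by rewrite -cmmulDl cmaddr0. Qed.

Lemma cmmul0N x : 0 * (- x) = 0 * x.
Proof. by rewrite -cmaddrN cmoppK cmaddC cmaddrN. Qed.

Lemma cmaddar x : \a + x = \a.
Proof. by rewrite cmaddC cmaddra. Qed.

Lemma cmmul0a : 0 * \a = \a :> M.
Proof. by rewrite -cmaddrN cmaddar. Qed.

Lemma cmmulra x : x * \a = \a.
Proof.
have {1}-> : x = 1 + (x + cmopp 1).
  by rewrite cmaddC cmaddA (cmaddC (cmopp 1)) cmaddrN cmmulr1 cmaddr0.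
by rewrite cmmulDl cmmul1r cmaddar.
Qed.

Lemma cmmular x : \a * x = \a.
Proof. by rewrite cmmulC cmmulra. Qed.

Lemma cmmul0_eqa x : 0 * x = \a -> x = \a.
Proof. by move=> x0a; rewrite -(cmaddr_mul0 x) x0a cmaddra. Qed.

Lemma cminv1 : 1^-1 = 1 :> M.
Proof. by have := cminv1D0 (0 : M); rewrite cmmul00 cmaddr0. Qed.

Lemma cmmul0rV x : 0 * (x * x^-1) = 0 * x^-1.
Proof. by rewrite cmmulrV cmmulDr cmmulr1 cmadd0r cmmul0K. Qed.

Lemma cmmul0_idem x : 0 * x * (0 * x) = 0 * x.
Proof.
(* [1 + 0 * x] is its own inverse, hence idempotent. *)
have idem : (1 + 0 * x) * (1 + 0 * x) = 1 + 0 * x.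
  rewrite -{2}(cminv1D0 x) cmmulrV cminv1D0.
  by rewrite cmmulDr cmmulr1 cmadd0r cmmul0K.
(* Both sides arise from [0 * x * (x + 0)], with and without distributing. *)
have absorb : 0 * x * (0 * x) + 0 * x = 0 * x * (0 * x).
  rewrite -cmmulA (cmmulC (0 * x) 0) cmmul0K.
  have := cmmulDr (0 * x) x 0.
  by rewrite cmaddr0 (cmmulC (0 * x) 0) cmmul0K => <-.
(* With [e = 0 * x], multiplying [idem] by [0] leaves [e + e * e = e], while [absorb] evaluates the
   same sum to [e * e]. *)
have := congr1 (cmmul 0) idem.
rewrite cmmulDl cmmul1r (cmmulDr (0 * x)) cmmulr1 (cmaddC (0 * x) (_ * _)).
rewrite absorb !cmmulDr cmmulr1 !cmadd0r cmmul0K -(cmmulA 0 (0 * x)) cmmul0K.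
by rewrite cmaddC absorb.
Qed.

Lemma cmmul0_absorb x : 0 * x * x = 0 * x.
Proof.
by rewrite -[RHS]cmmul0_idem -(cmmulA (0 * x)) (cmmulC (0 * x) 0) cmmul0K.
Qed.

Lemma fiber_zero z : zeros M z -> fiber z z.
Proof. by case=> x _ <-; exact: cmmul0K. Qed.

Lemma fiberD z x y : fiber z x -> fiber z y -> fiber z (x + y).
Proof. by rewrite /fiber/= => xz yz; rewrite cmmulDr xz yz -xz cmmul0_add. Qed.

Lemma fiberN z x : fiber z x -> fiber z (- x).
Proof. by rewrite /fiber/= cmmul0N. Qed.

Lemma fiberM z x y : fiber z x -> fiber z y -> fiber z (x * y).
Proof.
rewrite /fiber/= => xz yz.
have -> : 0 * (x * y) = 0 * x * (0 * y).
  by rewrite -(cmmulA (0 * x)) (cmmulC (0 * x) 0) cmmul0K cmmulA.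
by rewrite xz yz -xz cmmul0_idem.
Qed.

Lemma fiber_one z : zeros M z -> fiber z (1 + z).
Proof.
by move=> /fiber_zero zz; rewrite /fiber/= cmmulDr cmmulr1 cmadd0r zz.
Qed.

Lemma fiber_add0 z x : fiber z x -> z + x = x.
Proof. by rewrite cmaddC => <-; exact: cmaddr_mul0. Qed.

Lemma fiber_mul1 z x : fiber z x -> (1 + z) * x = x.
Proof.
by move=> <-; rewrite cmmulDl cmmul1r cmmul0_absorb cmaddr_mul0.
Qed.

(** If [1 + z = z], then [z] is its own inverse by [cminv1D0]; but [z = 0 * x] has inverse
    [\a * x^-1 = \a]. *)
Lemma fiber_neq1 z : zeros M z -> z <> \a -> 1 + z <> z.
Proof.
move=> [x _ <-] xNa xE; apply: xNa.
have : (0 * x)^-1 = 0 * x by rewrite -{1}xE cminv1D0 xE.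
by rewrite cminvM cminv0 cmmular.
Qed.

(** The ring laws of the fiber are inherited from [M], so the field property reduces to inverting
    each [x <> z] inside the fiber. *)
Lemma fiber_field z : zeros M z -> z <> \a ->
    (forall x, fiber z x -> x <> z -> fiber z x^-1 /\ x^-1 * x = 1 + z) ->
  fiber_is_field z.
Proof.
move=> zM zNa invM.
pose T := {x : M | fiber z x}.
have T_inj (u v : T) : sval u = sval v -> u = v.
  by apply: eq_sig_hprop => x; exact: Prop_irrelevance.
pose zero : T := exist _ z (fiber_zero zM).
pose one : T := exist _ (1 + z) (fiber_one zM).
pose add (u v : T) : T := exist _ _ (fiberD (svalP u) (svalP v)).
pose opp (u : T) : T := exist _ _ (fiberN (svalP u)).
pose mul (u v : T) : T := exist _ _ (fiberM (svalP u) (svalP v)).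
have addA : associative add by move=> u v w; apply: T_inj; rewrite /= cmaddA.
have addC : commutative add by move=> u v; apply: T_inj; exact: cmaddC.
have add0 : left_id zero add.
  by move=> u; apply: T_inj; exact: fiber_add0 (svalP u).
have addN : left_inverse zero opp add.
  by move=> u; apply: T_inj; rewrite /= cmaddC cmaddrN; exact: svalP u.
have mulA : associative mul by move=> u v w; apply: T_inj; rewrite /= cmmulA.
have mulC : commutative mul by move=> u v; apply: T_inj; exact: cmmulC.
have mul1 : left_id one mul.
  by move=> u; apply: T_inj; exact: fiber_mul1 (svalP u).
have mulD : left_distributive mul add.
  by move=> u v w; apply: T_inj; exact: cmmulDl.
(* A [fieldType] inverts zero to zero, whereas [z^-1 = \a] lies outside the fiber; hence the
   separate value at [zero]. *)
have inv_ex (u : T) :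
    {v : T | (u <> zero -> mul v u = one) /\ (u = zero -> v = zero)}.
  apply: cid; have [->|uN0] := pselect (u = zero); first by exists zero.
  have [|uV uVu] := invM _ (svalP u); first by move=> /(T_inj u zero).
  by exists (exist _ _ uV); split=> // _; exact: T_inj.
pose C : choiceType := HB.pack T (gen_eqMixin T) (gen_choiceMixin T).
pose Z : zmodType := HB.pack T C (GRing.isZmodule.Build C addA addC add0 addN).
have one_neq0 : (one : Z) != (zero : Z).
  by apply/eqP => /(congr1 (@sval _ _)); exact: fiber_neq1.
pose R : comNzRingType := HB.pack T Z
  (GRing.Zmodule_isComNzRing.Build Z mulA mulC mul1 mulD one_neq0).
pose inv (u : R) : R := sval (inv_ex u).
have mulVf (u : R) : u != 0%R -> (inv u * u = 1)%R.
  by move=> /eqP; case: (svalP (inv_ex u)).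
have inv0 : inv 0%R = 0%R by case: (svalP (inv_ex zero)) => _; exact.
pose F : fieldType := HB.pack T R (GRing.ComNzRing_isField.Build R mulVf inv0).
exists F, (fun u : T => sval u); split=> //; split=> //.
apply/seteqP; split=> [_ [u _ <-]|x xz]; first exact: (svalP u).
by exists (exist _ x xz).
Qed.

Lemma AVL_minimal_fiber_field z :
  AVL M -> zminimal (zeros M `\ \a) z -> fiber_is_field z.
Proof.
move=> avl [[zM /= zNa] zmin]; apply: fiber_field => // x xz xNz.
suff xVz : fiber z x^-1 by rewrite cmmulC cmmulrV xVz.
apply: zmin; first split.
- by exists x^-1.
(* If [x^-1] were [\a], AVL would give [x = 0 * x = z]. *)
- by move=> /cmmul0_eqa /avl xE; apply: xNz; rewrite -xE.
- rewrite /zle cmmulC -xz (cmmulC 0 x) cmmulA cmmul0K -cmmulA (cmmulC x 0).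
  by rewrite cmmulA cmmul0rV.
Qed.

Lemma NVL_zeros : NVL M <-> zeros M = [set \a; 0].
Proof.
split=> [nvl|zerosE x xNa].
  apply/seteqP; split=> [_ [x _ <-]|_ [->|->]].
  - have [->|/nvl ->] := pselect (x = \a); last by right.
    by left; exact: cmmul0a.
  - by exists \a => //; exact: cmmul0a.
  - by exists 0 => //; exact: cmmul00.
have : zeros M (0 * x) by exists x.
by rewrite zerosE => -[/cmmul0_eqa|].
Qed.

(** This lets the result on minimal fibers be applied to [M_0]. *)
Lemma NVL_zminimal0 : nontrivial M -> NVL M -> zminimal (zeros M `\ \a) 0.
Proof.
move=> nt /NVL_zeros ->; split; first by split=> //; right.
by move=> x [[->|->]] //= aNa; case: aNa.
Qed.

Lemma NVL_adjunction :
  nontrivial M -> NVL M -> is_adjunction_of_a (fiber (0 : M)).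
Proof.
move=> nt nvl; split.
- apply/seteqP; split=> // x _.
  by have [->|/nvl] := pselect (x = \a); [right|left].
- apply/seteqP; split=> // _ [/[swap] ->]; rewrite /fiber/= cmmul0a => a0.
  exact: nt.
- by move=> x; split; [exact: cmaddra|exact: cmmulra].
Qed.

Lemma adjunction_NVL_AVL (S : set M) :
  is_adjunction_of_a S -> is_field_on S 0 1 -> NVL M /\ AVL M.
Proof.
move=> [SUa SIa _] [F [i [[_ SE] [i0 i1] _ _ iM]]].
rewrite -{}SE in SUa SIa.
have range_i x : x <> \a -> exists u, i u = x.
  move=> xNa; have : [set: M] x by [].
  by rewrite -SUa => -[[u _ <-]|//]; exists u.
have neq1a : 1 <> \a :> M.
  move=> a1; suff : (range i `&` [set \a]) 1 by rewrite SIa.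
  by split=> //; exists 1%R.
split=> x.
  by move=> /range_i[u <-]; rewrite -i0 -iM GRing.mul0r.
have [-> _|/range_i[u <-]] := pselect (x = \a); first exact: cmmul0a.
have [->|u0] := eqVneq u 0%R; first by rewrite i0 cmmul00.
(* Inverting [1 = i u * i (u^-1)] in [M] gives [1] on one side and a product with the factor
   [(i u)^-1 = \a] on the other. *)
move=> uV; case: neq1a; rewrite -cminv1 -i1 -(GRing.mulfV u0).
by rewrite iM cminvM uV cmmular.
Qed.

Lemma CIL_NVL_AVL : nontrivial M -> CIL M <-> NVL M /\ AVL M.
Proof.
move=> nt; split=> [cil|[nvl avl] x xN0 xNa]; last first.
  (* By NVL, [1 + 0 * x^-1 = 1] unless [x^-1 = \a]; in that case AVL and NVL give
     [x = 0 * x = 0]. *)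
  rewrite cmmulrV nvl ?cmaddr0// => xVa.
  by apply: xN0; rewrite -(nvl x xNa) (avl x xVa).
split=> x.
  move=> xNa; have [->|xN0] := pselect (x = 0); first exact: cmmul00.
  (* Inserting [1 = x * x^-1], the factor [0 * x] absorbs [x], and [0 * x * x^-1 = 0 * 1 = 0]
     remains. *)
  rewrite -(cmmulr1 (0 * x)) -{1}(cil x) // -cmmulA.
  by rewrite cmmul0_absorb cmmulA cil ?cmmulr1.
move=> xVa; have [->|xN0] := pselect (x = 0); first exact: cmmul00.
have [->|xNa] := pselect (x = \a); first exact: cmmul0a.
have := cil x xN0 xNa; rewrite xVa cmmulra => a1.
(* From [\a = 1] follows [0 = 1 * 0 = \a * 0 = \a]. *)
by case: nt; rewrite -[LHS]cmmul1r -a1 cmmular.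
Qed.

End CommonMeadowTheory.

Theorem proposition5p4 (M : commonMeadow) :
  [/\ NVL M <-> zeros M = [set \a; 0],
      AVL M -> forall z : M, zminimal (zeros M `\ \a) z -> fiber_is_field z,
      nontrivial M ->
        ((NVL M /\ AVL M) <->
         exists S : set M, is_adjunction_of_a S /\ is_field_on S 0 1) &
      nontrivial M ->
        (CIL M <-> is_adjunction_of_a (fiber (0 : M)) /\ fiber_is_field (0 : M))].
Proof.
(* The fiber over [0], whose identity is [1 + 0 = 1], is the field in both (3) and (4). *)
have fwd : nontrivial M -> NVL M -> AVL M ->
    is_adjunction_of_a (fiber (0 : M)) /\ is_field_on (fiber (0 : M)) 0 1.
  move=> nt nvl avl; split; first exact: NVL_adjunction.
  have := AVL_minimal_fiber_field avl (NVL_zminimal0 nt nvl).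
  by rewrite /fiber_is_field cmaddr0.
split.
- exact: NVL_zeros.
- by move=> avl z; exact: AVL_minimal_fiber_field.
- move=> nt; split=> [[nvl avl]|[S [adj fld]]]; last first.
    exact: adjunction_NVL_AVL fld.
  by exists (fiber 0); exact: fwd.
- move=> nt; rewrite CIL_NVL_AVL// /fiber_is_field cmaddr0.
  by split=> [[nvl avl]|[adj fld]]; [exact: fwd|exact: adjunction_NVL_AVL fld].
Qed.
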